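(* Let $T_P$ be a finite set of predicate terms, $T_U$ a finite set of update terms, $AP=\{a_\tau:\tau\in T_P\cup T_U\}$, let $\varphi$ be a universally quantified ($\forall^*$) HyperTSL formula over $T_P,T_U$ and let $S$ be a Mealy machine over $AP$. If $S$ models the HyperLTL formula $\mathrm{transl}(\varphi)$, i.e. $\mathit{traces}(S)\models\mathrm{transl}(\varphi)$, then $S$ models $\varphi$.
   Context: TSL setting. Let $\mathcal V$ be a set of values with Booleans $\mathbb B$. Fix inputs $\mathbb I$, a finite set of cells $\mathbb C$, function symbols $\Sigma_F$ and predicate symbols $\Sigma_P\subseteq\Sigma_F$. Function terms $\tau::=s\mid f\,\tau_1\cdots\tau_n$ ($s\in\mathbb I\cup\mathbb C$), forming $\mathcal T_F$; predicate terms $p\,\tau_1\cdots\tau_n$; update terms $[c\leftarrow\tau]$. An interpretation $\langle\cdot\rangle$ maps symbols to functions $\mathcal V^n\to\mathcal V$ (predicates into $\mathbb B$). A computation is an infinite sequence $\varsigma$ of total maps $\mathbb C\to\mathcal T_F$; an input stream is an infinite sequence $\iota$ of maps $\mathbb I\to\mathcal V$; an execution is $(\varsigma,\iota)$. With initial values $\mathrm{init}_c$, evaluation: $\eta(\varsigma,\iota,i,s)=\iota(i)(s)$ for inputs; $\mathrm{init}_s$ for cells at $i=0$; $\eta(\varsigma,\iota,i-1,\varsigma(i-1)(s))$ for cells at $i>0$; $\eta(\varsigma,\iota,i,f\tau_1\cdots\tau_n)=\langle f\rangle(\eta(\cdot,\tau_1),\dots)$. HyperTSL: $\varphi::=\forall\pi.\varphi\mid\exists\pi.\varphi\mid\psi$,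 $\psi::=\neg\psi\mid\psi\wedge\psi\mid X\psi\mid\psi U\psi\mid(\tau^p)_\pi\mid[c\leftarrow\tau]_\pi$; ''over $T_P,T_U$'' means all its predicate/update terms lie in $T_P$/$T_U$. Over a set $E$ of executions: $[c\leftarrow\tau]_\pi$ holds at $i$ iff $\varsigma(i)(c)$ is syntactically $\tau$ for $(\varsigma,\iota)=\Pi(\pi)$; $(\tau^p)_\pi$ iff $\eta(\varsigma,\iota,i,\tau^p)$ true; LTL semantics for connectives; quantifiers over $E$; $E\models_{\langle\cdot\rangle}\varphi$ at time 0 with empty assignment. HyperLTL: same shape over traces in $(2^{AP})^\omega$ with atoms $a_\pi$ ($a\in\Pi(\pi)(i)$); $T\models\chi$ for trace sets $T$. Translation: $T_U^c$ = update terms of $T_U$ for cell $c$; $\mathit{cellProps}_\pi:=G\bigwedge_{c\in\mathbb C}\bigvee_{u\in T_U^c}((a_u)_\pi\wedge\bigwedge_{u'\in T_U^c\setminus\{u\}}\neg(a_{u'})_\pi)$ ($G$ = globally). For $\varphi=Q_1\pi_1\cdots Q_n\pi_n.\psi$, $\mathrm{transl}(\varphi)=Q_1\pi_1\cdots Q_n\pi_n.\psi'\wedge\bigwedge_j\mathit{cellProps}_{\pi_j}$, with $\psi'$ replacing each $(\tau)_\pi$ by $(a_\tau)_\pi$. For an interpretation and execution $e=(\varsigma,\iota)$, $\mathrm{transl}_{\langle\cdot\rangle}(e)$ has $i$-th letter $\{a_\tau:\tau\in T_P,\eta(\varsigma,\iota,i,\tau)\text{ true}\}\cup\{a_{[c\leftarrow\tau]}:[c\leftarrow\tau]\in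 T_U,\varsigma(i)(c)\equiv\tau\}$. Mealy machine: $S=(Q,2^{AP},\delta,q_0)$ with $\delta\subseteq Q\times 2^{AP}\times Q$; $\mathit{traces}(S)$ = label sequences of infinite paths from $q_0$. $S$ models the HyperTSL formula $\varphi$ iff for every interpretation $\langle\cdot\rangle$, $\{(\varsigma,\iota):\mathrm{transl}_{\langle\cdot\rangle}((\varsigma,\iota))\in\mathit{traces}(S)\}\models_{\langle\cdot\rangle}\varphi$. *)

(* Defs.v *)
From HB Require Import structures.
From mathcomp Require Import all_boot finmap.
From mathcomp Require Import boolp classical_sets.

Set Implicit Arguments.
Unset Strict Implicit.
Unset Printing Implicit Defensive.

Local Open Scope classical_set_scope.
Local Open Scope fset_scope.

Record signature := Signature {
  input : Type;
  cell : finType;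
  func : Type;
  arity : func -> nat;
  is_pred : pred func
}.

(* The inclusion of the Booleans in the values is the injection [of_bool]. *)
Record values := Values {
  value :> Type;
  of_bool : bool -> value;
  of_bool_inj : injective of_bool
}.

(* Arguments are finite functions, so that Leibniz equality of terms is
   syntactic equality. *)
Inductive term (S : signature) : Type :=
| Input of input S
| Cell of cell S
| App (f : func S) of {ffun 'I_(arity f) -> term S}.

HB.instance Definition _ (S : signature) := gen_eqMixin (term S).
HB.instance Definition _ (S : signature) := gen_choiceMixin (term S).

Definition is_pred_term (S : signature) (t : term S) : bool :=
  if t is App f _ then is_pred f else false.

Definition pred_term (S : signature) := {t : term S | is_pred_term t}.

(* [(c, t)] is the update term [c <- t]. *)
Definition update_term (S : signature) := (cell S * term S)%type.

HB.instance Definition _ (S : signature) := Choice.on (pred_term S).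
HB.instance Definition _ (S : signature) := Choice.on (update_term S).

Record interpretation (S : signature) (V : values) := Interpretation {
  interp :> forall f : func S, {ffun 'I_(arity f) -> V} -> V;
  interp_pred : forall p : func S, is_pred p ->
    forall v : {ffun 'I_(arity p) -> V}, exists b : bool,
      interp v = of_bool V b
}.

Definition computation (S : signature) := nat -> cell S -> term S.
Definition input_stream (S : signature) (V : values) := nat -> input S -> V.
Definition execution (S : signature) (V : values) :=
  (computation S * input_stream S V)%type.

Fixpoint eta (S : signature) (V : values) (init : cell S -> V)
    (I : interpretation S V) (sigma : computation S) (iota : input_stream S V)
    (i : nat) : term S -> V :=
  fix eta_i (t : term S) : V :=
    match t with
    | Input s => iota i s
    | Cell c => if i is j.+1 then eta init I sigma iota j (sigma j c) else init c
    | App f ts => I f [ffun k => eta_i (ts k)]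
    end.

(* Temporal formulas whose atoms [Atom a p] are elements [a] of [A] indexed by
   a path variable [p]; HyperTSL and HyperLTL differ only in [A] and in its
   interpretation. *)
Inductive ltl (A : Type) : Type :=
| Atom of A & nat
| Not of ltl A
| And of ltl A & ltl A
| Next of ltl A
| Until of ltl A & ltl A.

Inductive hyper (A : Type) : Type :=
| Forall of nat & hyper A
| Exists of nat & hyper A
| Body of ltl A.

Definition assignment (X : Type) := nat -> option X.

Definition assign (X : Type) (P : assignment X) (p : nat) (x : X) :
    assignment X :=
  fun q => if q == p then Some x else P q.

(* [holds x i a] : the atom [a] is true at time [i] on [x].  Atoms over an
   unassigned path variable, which do not occur when evaluating a closed
   formula, are false. *)
Fixpoint ltl_sat (A X : Type) (holds : X -> nat -> A -> Prop)
    (P : assignment X) (i : nat) (psi : ltl A) : Prop :=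
  match psi with
  | Atom a p => if P p is Some x then holds x i a else False
  | Not psi1 => ~ ltl_sat holds P i psi1
  | And psi1 psi2 => ltl_sat holds P i psi1 /\ ltl_sat holds P i psi2
  | Next psi1 => ltl_sat holds P i.+1 psi1
  | Until psi1 psi2 => exists j : nat, [/\ i <= j, ltl_sat holds P j psi2
      & forall k : nat, i <= k < j -> ltl_sat holds P k psi1]
  end.

Fixpoint hyper_sat (A X : Type) (holds : X -> nat -> A -> Prop) (E : set X)
    (P : assignment X) (phi : hyper A) : Prop :=
  match phi with
  | Forall p phi1 => forall x, E x -> hyper_sat holds E (assign P p x) phi1
  | Exists p phi1 => exists2 x, E x & hyper_sat holds E (assign P p x) phi1
  | Body psi => ltl_sat holds P 0 psi
  end.

Definition satisfies (A X : Type) (holds : X -> nat -> A -> Prop) (E : set X)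
    (phi : hyper A) : Prop :=
  hyper_sat holds E (fun _ => None) phi.

Fixpoint universal (A : Type) (phi : hyper A) : Prop :=
  match phi with
  | Forall _ phi1 => universal phi1
  | Exists _ _ => False
  | Body _ => True
  end.

Fixpoint quantified_vars (A : Type) (phi : hyper A) : seq nat :=
  match phi with
  | Forall p phi1 => p :: quantified_vars phi1
  | Exists p phi1 => p :: quantified_vars phi1
  | Body _ => [::]
  end.

Fixpoint map_body (A B : Type) (f : ltl A -> ltl B) (phi : hyper A) : hyper B :=
  match phi with
  | Forall p phi1 => Forall p (map_body f phi1)
  | Exists p phi1 => Exists p (map_body f phi1)
  | Body psi => Body (f psi)
  end.

Fixpoint map_atoms (A B : Type) (f : A -> B) (psi : ltl A) : ltl B :=
  match psi with
  | Atom a p => Atom (f a) p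
  | Not psi1 => Not (map_atoms f psi1)
  | And psi1 psi2 => And (map_atoms f psi1) (map_atoms f psi2)
  | Next psi1 => Next (map_atoms f psi1)
  | Until psi1 psi2 => Until (map_atoms f psi1) (map_atoms f psi2)
  end.

Fixpoint all_atoms (A : Type) (Q : A -> Prop) (psi : ltl A) : Prop :=
  match psi with
  | Atom a _ => Q a
  | Not psi1 => all_atoms Q psi1
  | And psi1 psi2 => all_atoms Q psi1 /\ all_atoms Q psi2
  | Next psi1 => all_atoms Q psi1
  | Until psi1 psi2 => all_atoms Q psi1 /\ all_atoms Q psi2
  end.

Fixpoint hyper_all_atoms (A : Type) (Q : A -> Prop) (phi : hyper A) : Prop :=
  match phi with
  | Forall _ phi1 => hyper_all_atoms Q phi1
  | Exists _ phi1 => hyper_all_atoms Q phi1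
  | Body psi => all_atoms Q psi
  end.

(* The grammar has no constants: [top_of psi] is a tautology built from an
   arbitrary formula [psi].  The base cases of the big connectives take such a
   tautology [t] as a parameter. *)
Definition top_of (A : Type) (psi : ltl A) : ltl A := Not (And psi (Not psi)).

Definition Or (A : Type) (psi1 psi2 : ltl A) : ltl A :=
  Not (And (Not psi1) (Not psi2)).

Definition Globally (A : Type) (psi : ltl A) : ltl A :=
  Not (Until (top_of psi) (Not psi)).

Definition BigAnd (A : Type) (t : ltl A) (s : seq (ltl A)) : ltl A :=
  foldr (@And A) t s.

Definition BigOr (A : Type) (t : ltl A) (s : seq (ltl A)) : ltl A :=
  foldr (@Or A) (Not t) s.

Definition tsl_atom (S : signature) := (pred_term S + update_term S)%type.

Definition hyperTSL (S : signature) := hyper (tsl_atom S).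

Definition tsl_holds (S : signature) (V : values) (init : cell S -> V)
    (I : interpretation S V) (e : execution S V) (i : nat) (a : tsl_atom S) :
    Prop :=
  match a with
  | inl t => eta init I e.1 e.2 i (val t) = of_bool V true
  | inr u => e.1 i u.1 = u.2
  end.

Definition models_hyperTSL (S : signature) (V : values) (init : cell S -> V)
    (I : interpretation S V) (E : set (execution S V)) (phi : hyperTSL S) :
    Prop :=
  satisfies (tsl_holds init I) E phi.

Definition in_terms (S : signature) (TP : {fset pred_term S})
    (TU : {fset update_term S}) (a : tsl_atom S) : Prop :=
  match a with
  | inl t => t \in TP
  | inr u => u \in TU
  end.

Definition over_terms (S : signature) (TP : {fset pred_term S})
    (TU : {fset update_term S}) (phi : hyperTSL S) : Prop :=
  hyper_all_atoms (in_terms TP TU) phi.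

(* Names [a_ t] of atomic propositions, for all predicate and update terms [t];
   the set [AP TP TU] consists of those with [t] in [TP] or [TU]. *)
Inductive prop (S : signature) : Type := a_ of tsl_atom S.

Definition AP (S : signature) (TP : {fset pred_term S})
    (TU : {fset update_term S}) : set (prop S) :=
  [set a_ t | t in [set t | in_terms TP TU t]].

Definition trace (X : Type) := nat -> set X.

Definition hyperLTL (X : Type) := hyper X.

Definition models_hyperLTL (X : Type) (T : set (trace X)) (chi : hyperLTL X) :
    Prop :=
  satisfies (fun (w : trace X) i a => w i a) T chi.

Record mealy (X : Type) (ap : set X) := Mealy {
  state : Type;
  delta : state -> set X -> state -> Prop;
  delta_letter : forall q l q', delta q l q' -> (l `<=` ap)%classic;
  start : state
}.

Definition traces (X : Type) (ap : set X) (M : mealy ap) : set (trace X) :=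
  [set w : trace X | exists r : nat -> state M,
     r 0 = start M /\ forall i, delta (r i) (w i) (r i.+1)].

Definition updates_of (S : signature) (TU : {fset update_term S})
    (c : cell S) : {fset update_term S} :=
  [fset u in TU | u.1 == c].

Definition cell_props (S : signature) (TU : {fset update_term S})
    (t : ltl (prop S)) (p : nat) : ltl (prop S) :=
  let a u := Atom (a_ (inr u)) p in
  Globally (BigAnd t [seq
    BigOr t [seq
      And (a u) (BigAnd t [seq Not (a u') | u' <- updates_of TU c `\ u])
      | u <- updates_of TU c]
    | c <- enum (cell S)]).

Definition transl (S : signature) (TU : {fset update_term S})
    (phi : hyperTSL S) : hyperLTL (prop S) :=
  map_body (fun psi => let psi' := map_atoms (@a_ S) psi in
    And psi' (BigAnd (top_of psi')
      [seq cell_props TU (top_of psi') p | p <- quantified_vars phi])) phi.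

Definition transl_exec (S : signature) (V : values) (init : cell S -> V)
    (TP : {fset pred_term S}) (TU : {fset update_term S})
    (I : interpretation S V) (e : execution S V) : trace (prop S) :=
  fun i =>
    ([set a_ (inl t) | t in [set t : pred_term S |
        t \in TP /\ eta init I e.1 e.2 i (val t) = of_bool V true]] `|`
     [set a_ (inr u) | u in [set u : update_term S |
        u \in TU /\ e.1 i u.1 = u.2]])%classic.

Definition mealy_models_hyperLTL (X : Type) (ap : set X) (M : mealy ap)
    (chi : hyperLTL X) : Prop :=
  models_hyperLTL (traces M) chi.

Definition mealy_models_hyperTSL (S : signature) (V : values)
    (init : cell S -> V) (TP : {fset pred_term S}) (TU : {fset update_term S})
    (M : mealy (AP TP TU)) (phi : hyperTSL S) : Prop :=
  forall I : interpretation S V,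
    models_hyperTSL init I
      [set e : execution S V | traces M (transl_exec init TP TU I e)] phi.

(* Main.v *)
(** Since [phi] is universal, it is enough that every assignment of executions
    whose translations lie in [traces M] maps, by translating pointwise, to an
    assignment of traces of [M] on which the atoms of [phi] have the same truth
    values; the conjuncts [cell_props] only strengthen the hypothesis. *)
Require Import Defs.
From mathcomp Require Import all_boot finmap.
From mathcomp Require Import boolp classical_sets.

Lemma omap_assign {X Y : Type} (g : X -> Y) (P : assignment X) (p : nat)
    (x : X) :
  (fun q => omap g (assign P p x q)) = assign (fun q => omap g (P q)) p (g x).
Proof. by apply/funext => q; rewrite /assign; case: (q == p). Qed.

Section Transfer.
Context {A B X Y : Type}.
Variables (holdsX : X -> nat -> A -> Prop) (holdsY : Y -> nat -> B -> Prop).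
Variables (f : A -> B) (g : X -> Y) (Q : A -> Prop).
(** The restriction to [Q] is needed because a translated trace records only the terms of [TP] and
    [TU]. *)
Hypothesis holdsE :
  forall x i a, Q a -> holdsY (g x) i (f a) <-> holdsX x i a.

(** The map [g] leaves time unchanged, so temporal connectives carry over; [omap] keeps unassigned
    variables unassigned. *)
Lemma ltl_sat_map_atoms (psi : ltl A) : all_atoms Q psi ->
  forall (P : assignment X) (i : nat),
    ltl_sat holdsY (fun q => omap g (P q)) i (map_atoms f psi) <->
    ltl_sat holdsX P i psi.
Proof.
elim: psi => [a p|psi IH|psi1 IH1 psi2 IH2|psi IH|psi1 IH1 psi2 IH2] /=.
- by move=> Qa P i; case: (P p) => //= x; exact: holdsE.
- by move=> Qpsi P i; rewrite (IH Qpsi).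
- by move=> [Q1 Q2] P i; rewrite (IH1 Q1) (IH2 Q2).
- by move=> Qpsi P i; exact: IH.
- move=> [Q1 Q2] P i; split=> -[j [ij s2 s1]]; exists j; split=> //.
  + exact/(IH2 Q2).
  + by move=> k /s1 /(IH1 Q1).
  + exact/(IH2 Q2).
  + by move=> k /s1 /(IH1 Q1).
Qed.

(** In [transl] the extra conjunct mentions all quantified variables of the whole formula; an
    arbitrary [chi] stays fixed while the induction strips quantifiers. An existential witness in
    [T] might lie outside the image of [g]. *)
Lemma universal_hyper_sat_map_body (T : set Y) (chi : ltl A -> ltl B)
    (phi : hyper A) (P : assignment X) :
  hyper_all_atoms Q phi -> universal phi ->
  hyper_sat holdsY T (fun q => omap g (P q))
    (map_body (fun psi => And (map_atoms f psi) (chi psi)) phi) ->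
  hyper_sat holdsX [set x | T (g x)]%classic P phi.
Proof.
elim: phi P => [p phi IH|//|psi] P /= Qphi univ.
- move=> sat x Tx; apply: IH => //.
  (* The quantifier over [T] is instantiated at [g x]. *)
  by rewrite omap_assign; exact: sat.
- by move=> [/(ltl_sat_map_atoms _ Qphi)].
Qed.

End Transfer.

Lemma transl_execE (S : signature) (V : values) (init : cell S -> V)
    (TP : {fset pred_term S}) (TU : {fset update_term S})
    (I : interpretation S V) (e : execution S V) (i : nat) (a : tsl_atom S) :
  in_terms TP TU a ->
  transl_exec init TP TU I e i (a_ a) <-> tsl_holds init I e i a.
Proof.
case: a => [t|u] /= inT; split.
- by case=> -[? [_ ht]] // [<-].
- by move=> ht; left; exists t.
- by case=> -[? [_ hu]] // [<-].
- by move=> hu; right; exists u.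
Qed.

Theorem theorem6 (S : signature) (V : values) (init : cell S -> value V)
    (TP : {fset pred_term S}) (TU : {fset update_term S})
    (phi : hyperTSL S) (M : mealy (AP TP TU)) :
  over_terms TP TU phi -> universal phi ->
  mealy_models_hyperLTL M (transl TU phi) ->
  mealy_models_hyperTSL init M phi.
Proof.
move=> overT univ sat I.
(* Unification finds [chi], and the empty assignment is its own image under [omap] by
   computation. *)
apply: (universal_hyper_sat_map_body (tsl_holds init I)
  (fun (w : trace (prop S)) i a => w i a) (@a_ S) (transl_exec init TP TU I)
  (in_terms TP TU) _ (traces M) _ phi (fun=> None) overT univ sat).
exact: transl_execE.
Qed.
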